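(* Let $(X,d)$ be a nonempty compact metric space, let $m\ge1$, let $f_0,\dots,f_{m-1}:X\to X$ be continuous maps and let $G=\{f_0,\dots,f_{m-1}\}$ be the free semigroup action they generate. Suppose $G$ is chain transitive. Let $\sim$ be the equivalence relation on $X$ defined in the context. Then either (1) there is a period $k\ge1$ such that $G$ cyclically permutes $k$ closed and open $\sim$-equivalence classes of $X$ (that is, $X$ is the disjoint union of $k$ classes $X_0,\dots,X_{k-1}$, each both open and closed, with $f_j(X_i)\subset X_{(i+1)\bmod k}$ for all $0\le j\le m-1$ and $0\le i\le k-1$), and $G^k$ restricted to each equivalence class is chain mixing; or (2) $G$ factors onto an adding machine map, that is, there are a sequence $J=(j_1,j_2,\dots)$ of integers $\ge2$ and a continuous surjection $\pi:X\to X_J$ with $\pi\circ f_j=f_J\circ\pi$ for all $0\le j\le m-1$.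
   Context: $F_m^+$ is the set of nonempty finite words in the symbols $0,\dots,m-1$; $|w|$ is the length of $w$; for $w=i_0\cdots i_{k-1}$, $f_w=f_{i_0}\circ\cdots\circ f_{i_{k-1}}$. For $w=i_0\cdots i_{n-1}\in F_m^+$ and $\varepsilon>0$, a $(w,\varepsilon)$-chain of $G$ from $x$ to $y$ is a sequence $(x_0=x,x_1,\dots,x_n=y)$ in $X$ with $d(f_{i_j}(x_j),x_{j+1})\le\varepsilon$ for $j=0,\dots,n-1$; its length is $n=|w|$. $G$ is chain transitive if for every $\varepsilon>0$ and all $x,y\in X$ there is a $(w,\varepsilon)$-chain from $x$ to $y$ for some $w\in F_m^+$. $G$ is chain mixing if for every $\varepsilon>0$ there is $N>0$ such that for all $x,y\in X$ and all $n\ge N$ there is a $(w,\varepsilon)$-chain from $x$ to $y$ for some $w\in F_m^+$ with $|w|=n$. The same definitions apply to any finite family of continuous self-maps of a compact metric space. For $k\in\mathbb N$, $G^k$ is the free semigroup action generated by the $m^k$ maps $\{f_w: w\in F_m^+,\ |w|=k\}$; ''$G^k$ restricted to a class'' refers to the restrictions of these maps to that class, which they leave invariant. Equivalence relation. Assume $G$ is chain transitive. For $\varepsilon>0$ let $T_\varepsilon(x)$ be the set of lengths of all $(w,\varepsilon)$-chains, $w\in F_m^+$, from $x$ to itself, and let $k_\varepsilon=\gcd(T_\varepsilon(x))$, which does not depend on $x$. Write $x\sim_\varepsilon y$ if there is a $(w,\varepsilon)$-chain from $x$ to $y$ of length a multiple of $k_\varepsilon$ for some $w\in F_m^+$; this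 is an equivalence relation. Write $x\sim y$ if $x\sim_\varepsilon y$ for all $\varepsilon>0$. Adding machine. For a sequence $J=(j_1,j_2,\dots)$ of integers $\ge2$, $X_J$ is the Cantor set (product topology) of all sequences $(a_1,a_2,\dots)$ with $a_i\in\{0,1,\dots,j_i-1\}$, and $f_J:X_J\to X_J$ is $f_J(a_1,a_2,\dots)=(a_1,a_2,\dots)+(1,0,0,\dots)$, with addition componentwise mod $j_i$ and carrying to the right. *)

(* Defs.v *)
From HB Require Import structures.
From mathcomp Require Import all_boot all_order all_algebra.
From mathcomp Require Import all_classical all_reals all_analysis.

Set Implicit Arguments.
Unset Strict Implicit.
Unset Printing Implicit Defensive.

Import Order.TTheory GRing.Theory Num.Theory.

Local Open Scope classical_set_scope.
Local Open Scope ring_scope.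

Definition is_gcd_set (T : set nat) (k : nat) : Prop :=
  (forall n, T n -> (k %| n)%N) /\
  (forall d, (forall n, T n -> (d %| n)%N) -> (d %| k)%N).

Definition gcd_set (T : set nat) : nat := xget 0%N [set k | is_gcd_set T k].

(* The default value of [xget] is never used. *)
Lemma gcd_setP (T : set nat) : is_gcd_set T (gcd_set T).
Proof.
suff [k Tk] : exists k, is_gcd_set T k by exact: (xgetPex 0%N (ex_intro _ k Tk)).
have [[n [Tn n0]]|Tle0] := pselect (exists n, T n /\ (0 < n)%N); last first.
  exists 0%N; split=> [n Tn|d _]; last exact: dvdn0.
  case: (posnP n) => [->|n0]; first by rewrite dvdn0.
  by exfalso; apply: Tle0; exists n.
pose cd (d : nat) := `[< forall p, T p -> (d %| p)%N >].
exists (\big[lcmn/1%N]_(d < n.+1 | cd d) d)%N; split.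
- by move=> p Tp; apply/dvdn_biglcmP => d /asboolP; apply.
- move=> d dT; have dn : (d < n.+1)%N by rewrite ltnS dvdn_leq// dT.
  by apply: (biglcmn_sup (Ordinal dn)) => //; apply/asboolP.
Qed.

Section chains.
Context {R : realType} {X : metricType R}.

Definition word_map {I : Type} (f : I -> X -> X) (w : seq I) : X -> X :=
  foldr (fun i g => f i \o g) id w.

(* The generators of G^k, indexed by the words of length k. *)
Definition power_family {I : Type} (f : I -> X -> X) (k : nat) :
  k.-tuple I -> X -> X := fun w => word_map f w.

(* (w, eps)-chain from x to y for the restrictions to A of the maps f i, where
   A is a subset of X left invariant by them: all the points lie in A.
   Only the values c 0, ..., c n of c matter. *)
Definition is_chain {I : Type} (A : set X) (f : I -> X -> X) (n : nat)
    (w : n.-tuple I) (eps : R) (x y : X) (c : nat -> X) : Prop :=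
  [/\ c 0%N = x, c n = y,
      (forall j : nat, (j <= n)%N -> A (c j)) &
      forall j : 'I_n, mdist (f (tnth w j) (c j)) (c j.+1) <= eps].

(* The words of a chain are nonempty, whence 0 < n. *)
Definition chain_length {I : Type} (A : set X) (f : I -> X -> X) (eps : R)
    (x y : X) : set nat :=
  [set n | (0 < n)%N /\ exists (w : n.-tuple I) c, is_chain A f w eps x y c].

Definition chain_transitive {I : Type} (A : set X) (f : I -> X -> X) : Prop :=
  forall eps : R, 0 < eps -> forall x y, A x -> A y ->
    exists n, chain_length A f eps x y n.

Definition chain_mixing {I : Type} (A : set X) (f : I -> X -> X) : Prop :=
  forall eps : R, 0 < eps -> exists N : nat, (0 < N)%N /\
    forall x y, A x -> A y -> forall n, (N <= n)%N ->
      chain_length A f eps x y n.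

Definition chain_period {I : Type} (f : I -> X -> X) (eps : R) (x : X) : nat :=
  gcd_set (chain_length setT f eps x x).

Definition sim_eps {I : Type} (f : I -> X -> X) (eps : R) (x y : X) : Prop :=
  exists n, chain_length setT f eps x y n /\ (chain_period f eps x %| n)%N.

Definition sim {I : Type} (f : I -> X -> X) (x y : X) : Prop :=
  forall eps : R, 0 < eps -> sim_eps f eps x y.

Definition sim_class {I : Type} (f : I -> X -> X) (A : set X) : Prop :=
  exists x, A = [set y | sim f x y].

End chains.

(* The space X_J; indices start at 0 instead of 1. *)
Definition adding_space (J : nat -> nat) : Type :=
  prod_topology (fun i => discrete_topology 'I_(J i)).

HB.instance Definition _ (J : nat -> nat) := Choice.on (adding_space J).
HB.instance Definition _ (J : nat -> nat) := Nbhs.on (adding_space J).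
HB.instance Definition _ (J : nat -> nat) := Topological.on (adding_space J).

Section adding_machine.
Context {J : nat -> nat} (J2 : forall i, (2 <= J i)%N).

Fixpoint carry (a b : forall i, 'I_(J i)) (i : nat) : nat :=
  if i is i'.+1 then ((a i' + b i' + carry a b i') %/ J i')%N else 0%N.

Definition adding_add (a b : adding_space J) : adding_space J :=
  fun i => Ordinal (ltn_pmod (a i + b i + carry a b i)%N (ltnW (J2 i))).

(* (1, 0, 0, ...) *)
Definition adding_one : adding_space J :=
  fun i => Ordinal (leq_ltn_trans (leq_b1 (i == 0%N)) (J2 i)).

Definition adding_map (a : adding_space J) : adding_space J :=
  adding_add a adding_one.

End adding_machine.

(* Main.v *)
Require Import Defs.
From HB Require Import structures.
From mathcomp Require Import all_boot all_order all_algebra.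
From mathcomp Require Import all_classical all_reals all_analysis.
From mathcomp Require Import zify.

Set Implicit Arguments.
Unset Strict Implicit.
Unset Printing Implicit Defensive.

Import Order.TTheory GRing.Theory Num.Theory.

Local Open Scope classical_set_scope.
Local Open Scope ring_scope.

(** For a base point [x0], let [k e] be the gcd of the lengths of the [e]-chains
    from [x0] to itself. The length of an [e]-chain from [x0] to [y] is well
    defined modulo [k e]; this residue, the rank of [y], is locally constant, is
    raised by 1 by each generator and determines the class of [y] for [~_e].
    Moreover [k e] divides [k d] for [d <= e].
    If [k e] is bounded, it is constant for small [e]: the level sets of the rank
    are then the classes of [~], and since an additive set of integers contains
    all large multiples of its gcd, chains of all large lengths allowed by the
    rank exist, uniformly by compactness.
    If [k e] is unbounded, take [e_n] decreasing with [k e_n] strictly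
    increasing: the ranks at the scales [e_n] are compatible and are the digits
    of the factor map in the mixed radix system with place values [k e_n]. *)

(** * Additive sets of integers *)

Lemma additive_set_multiples (T : set nat) (k : nat) :
  (forall a b, T a -> T b -> T (a + b)%N) ->
  (exists2 t, (0 < t)%N & T t) -> is_gcd_set T k ->
  exists N, forall n, (N <= n)%N -> T (k * n)%N.
Proof.
move=> Tadd [t t0 Tt] [kT kgcd].
have Tmul n a : (0 < n)%N -> T a -> T (n * a)%N.
  case: n => // n _ Ta; elim: n => [|n IHn]; first by rewrite mul1n.
  by rewrite mulSn; exact: Tadd.
(* The least positive difference [d] of two elements of [T] divides all of [T],
   for otherwise [u %% d] would be a smaller one. Hence [d = k], and large
   multiples of [k] are combinations of [a] and [a + k]. *)
pose D d := `[< (0 < d)%N /\ exists2 a, T a & T (a + d)%N >].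
have exD : exists d, D d.
  by exists t; apply/asboolP; split => //; exists t => //; exact: Tadd.
case: (ex_minnP exD) => d /asboolP[d0 [a Ta Tad]] dmin.
have d_dvd u : T u -> (d %| u)%N.
  move=> Tu; rewrite /dvdn; apply/negPn/negP => ud0.
  suff : D (u %% d)%N by move=> /dmin; rewrite leqNgt ltn_pmod.
  apply/asboolP; split; first by rewrite lt0n.
  (* With [q = u %/ d], both [q * (a + d) + a] and [q * a + a + u] lie in [T], and they differ by
     [u %% d]. *)
  exists (u %/ d * (a + d) + a)%N.
    by case: (u %/ d)%N => [|q] //; apply: Tadd => //; exact: Tmul.
  have -> : (u %/ d * (a + d) + a + u %% d = u %/ d * a + a + u)%N.
    by have := divn_eq u d; lia.
  apply: (Tadd) => //.
  by case: (u %/ d)%N => [|q] //; apply: Tadd => //; exact: Tmul.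
have dk : d = k.
  apply/eqP; rewrite eqn_dvd kgcd//=.
  by rewrite -(dvdn_addr d (kT _ Ta)) kT.
subst d; have /dvdnP[b ab] := kT _ Ta.
have [b0|b0] := posnP b.
  exists 1%N => n n0; rewrite mulnC; apply: Tmul => //.
  by move: Tad; rewrite ab b0 mul0n add0n.
(* Write [n = q * b + s] with [s < b]; since [a = b * k], [k * n = (q - s) * a + s * (a + k)]. The
   bound [b * b] forces [q >= b > s]. *)
exists (b * b)%N => n bn.
have bq : (b <= n %/ b)%N by rewrite leq_divRL.
have sb : (n %% b < b)%N by rewrite ltn_pmod.
have -> : (k * n = (n %/ b - n %% b) * a + n %% b * (a + k))%N.
  have sq : (n %% b <= n %/ b)%N by exact: leq_trans (ltnW sb) bq.
  rewrite mulnDr addnA -mulnDl subnK//.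
  have := divn_eq n b; move: (n %/ b)%N (n %% b)%N => q s ->.
  by rewrite ab; lia.
have qs0 : (0 < n %/ b - n %% b)%N by rewrite subn_gt0 (leq_trans sb).
have Tqs := Tmul _ _ qs0 Ta.
have [s0|s0] := posnP (n %% b)%N; first by rewrite {2}s0 mul0n addn0.
by apply: Tadd => //; exact: Tmul.
Qed.

(** * Mixed radix digits and addition of 1 with carry *)

Section mixed_radix.
Context {J P : nat -> nat} (J2 : forall i, (2 <= J i)%N).
Context (P0 : P 0 = 1%N) (PS : forall i, P i.+1 = (P i * J i)%N).

Let P_gt0 i : (0 < P i)%N.
Proof. by elim: i => [|i IHi]; rewrite ?P0 // PS muln_gt0 IHi ltnW. Qed.

Definition radix_digit (n i : nat) : nat := (n %/ P i %% J i)%N.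

Lemma radix_digit_mod n n' i :
  n = n' %[mod P i.+1] -> radix_digit n i = radix_digit n' i.
Proof. by rewrite /radix_digit !modn_divl PS mulnC => ->. Qed.

(* Adding 1 in the mixed radix system: the carry into place [i], which includes
   the digit of the summand 1 at [i = 0], is 1 iff all lower digits of [n] are
   maximal. *)
Lemma carry_digit (a : adding_space J) n i :
  (forall l, (l < i)%N -> a l = radix_digit n l :> nat) ->
  ((i == 0%N) + carry a (adding_one J2) i = (n %% P i).+1 %/ P i)%N.
Proof.
elim: i => [|i IHi] ai; first by rewrite P0 modn1.
rewrite add0n /= ai// -addnA {}IHi => [|l li]; first last.
  by apply: ai; rewrite ltnW.
rewrite /radix_digit PS divnMA; congr divn.
have -> : (n %% (P i * J i) = n %/ P i %% J i * P i + n %% P i)%N.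
  rewrite modn_divl (mulnC (J i)) {1}(divn_eq (n %% (P i * J i)) (P i)).
  by rewrite modn_dvdm// dvdn_mulr.
by rewrite -addnS divnMDl.
Qed.

Lemma adding_map_digit (a : adding_space J) n i :
  (forall l, (l <= i)%N -> a l = radix_digit n l :> nat) ->
  adding_map J2 a i = radix_digit n.+1 i :> nat.
Proof.
move=> ai /=; rewrite -addnA (carry_digit (n := n)); first last.
  by move=> l /ltnW; exact: ai.
rewrite ai// /radix_digit modnDml; congr modn.
by rewrite [in RHS](divn_eq n (P i)) -addnS divnMDl.
Qed.

Lemma radix_digit_surj (a : adding_space J) i :
  exists n, forall l, (l < i)%N -> a l = radix_digit n l :> nat.
Proof.
(* The bound [n < P i] serves the induction: it makes [a i] the digit of [a i * P i + n] at place
   [i]. *)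
suff [n [nP an]] : exists n, (n < P i)%N /\
  forall l, (l < i)%N -> a l = radix_digit n l :> nat by exists n.
elim: i => [|i [n [nP an]]]; first by exists 0%N; rewrite P0.
exists (a i * P i + n)%N; split.
  rewrite PS mulnC; apply: (@leq_trans (P i * (a i).+1)).
    by rewrite mulnS addnC ltn_add2r.
  by rewrite leq_mul2l ltn_ord orbT.
move=> l; rewrite ltnS leq_eqVlt => /predU1P[->|li].
  by rewrite /radix_digit divnMDl// divn_small// addn0 modn_small.
rewrite an//; apply: radix_digit_mod.
suff /dvdnP[q ->] : (P l.+1 %| P i)%N by rewrite mulnA modnMDl.
elim: i li {an nP} => // i IHi; rewrite ltnS leq_eqVlt => /predU1P[->//|/IHi].
by rewrite [P i.+1]PS => ?; rewrite dvdn_mulr.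
Qed.

End mixed_radix.

(** * Chains as an inductive relation *)

Section reach.
Context {R : realType} {X : metricType R}.
Implicit Types (A : set X) (e d : R) (x y z : X) (n p k : nat).

(* [chain_length] without the word and the points of the chain; the value
   n = 0 is allowed, see [chain_lengthP]. *)
Fixpoint reach {I : Type} A (f : I -> X -> X) e n x y : Prop :=
  if n is n'.+1 then exists i z, [/\ A x, mdist (f i x) z <= e
                                   & reach A f e n' z y]
  else A x /\ x = y.

Lemma chain_lengthP {I : Type} A (f : I -> X -> X) e x y n :
  chain_length A f e x y n <-> (0 < n)%N /\ reach A f e n x y.
Proof.
suff chainP : (exists (w : n.-tuple I) c, is_chain A f w e x y c) <->
    reach A f e n x y by split=> -[n0 /chainP].
elim: n x => [|n IHn] x; split.
- by move=> [w [c [<- <- cA _]]]; split => //; exact: cA.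
- move=> [Ax xy]; exists [tuple], (fun=> x); split => //.
  by case.
- move=> [w [c [c0 cn cA cw]]]; exists (thead w), (c 1%N); split.
  + by rewrite -c0; exact: cA.
  + by have := cw ord0; rewrite c0.
  + apply/IHn; exists [tuple of behead w], (fun j => c j.+1); split => //.
      by move=> j jn; exact: cA.
    move=> j; rewrite tnth_behead.
    by have := cw (inord j.+1); rewrite inordK ?ltnS.
- move=> [i [z [Ax xz /IHn[w [c [c0 cn cA cw]]]]]].
  exists [tuple of i :: w], (fun j => if j is j'.+1 then c j' else x).
  split => //; first by case => // j; exact: cA.
  move=> j; have [j'|] := unliftP ord0 j.
    by move=> ->; rewrite tnthS /=; exact: cw.
  by move=> ->; rewrite tnth0 c0.
Qed.

Section family.
Context {I : Type} (f : I -> X -> X).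

Lemma reach_start A e n x y : reach A f e n x y -> A x.
Proof. by case: n => [[]//|n [i [z []]]]. Qed.

Lemma reach_cat A e n p x y :
  reach A f e (n + p) x y <->
  exists z, reach A f e n x z /\ reach A f e p z y.
Proof.
elim: n x => [|n IHn] x /=.
  split=> [xy|[z [[Ax ->]]]//].
  by exists x; split => //; split => //; exact: reach_start xy.
split=> [[i [z [Ax xz /IHn[t [zt ty]]]]]|[t [[i [z [Ax xz zt]] ty]]]].
  by exists t; split => //; exists i, z.
by exists i, z; split => //; apply/IHn; exists t.
Qed.

Lemma reach_weaken A e d n x y :
  d <= e -> reach A f d n x y -> reach A f e n x y.
Proof.
move=> de; elim: n x => // n IHn x [i [z [Ax xz /IHn zy]]].
by exists i, z; split => //; exact: le_trans de.
Qed.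

Lemma reach_orbit e n x i : 0 <= e -> reach setT f e n x (iter n (f i) x).
Proof.
move=> e0; elim: n x => [|n IHn] x //; exists i, (f i x); rewrite iterSr.
by split => //; rewrite mdistxx.
Qed.

(** The last jump is redirected to [y']; [0 < n] ensures that there is one. *)
Lemma reach_last e d n x y y' : 0 <= d -> (0 < n)%N ->
  reach setT f e n x y -> mdist y y' <= d -> reach setT f (e + d) n x y'.
Proof.
move=> d0; case: n => // n _ xy yy'; elim: n x xy => [|n IHn] x.
  move=> [i [z [_ xz [_ zy]]]]; subst z; exists i, y'; split=> //.
  by rewrite (le_trans (metric_triangle _ y _))// lerD.
move=> [i [z [_ xz /IHn zy]]]; exists i, z; split => //.
by rewrite (le_trans xz)// lerDl.
Qed.

End family.

(** * Compactness, and passage from chains of $G$ to chains of $G^k$ *)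

Section compactness.
Context {I : finType} (f : I -> X -> X).
Context (X_compact : compact [set: X]) (f_cont : forall i, continuous (f i)).
Import numFieldTopology.Exports.

Lemma uniform_modulus e : 0 < e -> exists2 d : R, 0 < d &
  forall i x y, mdist x y <= d -> mdist (f i x) (f i y) <= e.
Proof.
move=> e0.
pose P d x := forall i y, mdist x y <= d -> mdist (f i x) (f i y) <= e.
suff : \forall d \near 0^'+, [set: X] `<=` P d.
  move=> XP; near (0 : R)^'+ => d; exists d => // i x y.
  have dP : [set: X] `<=` P d by near: d.
  exact: dP.
apply: ((compact_near_coveringP _).1 X_compact) => x _.
have : \forall y \near x, forall i, mdist (f i x) (f i y) < e / 2.
  apply: filter_forall => i; have e20 : 0 < e / 2 by rewrite divr_gt0.
  have := f_cont (x := x) (nbhsx_ballx (f i x) _ e20).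
  by rewrite ballEmdist.
move=> /metricType_numDomainType.nbhs_mdistP[r /= r0 fr].
have r20 : 0 < r / 2 by rewrite divr_gt0.
near=> y d => i z yz.
have xy : mdist x y < r / 2.
  by near: y; have := nbhsx_ballx x _ r20; rewrite ballEmdist.
have dr : d < r / 2 by near: d; exact: nbhs_right_lt.
have xz : mdist x z < r.
  rewrite (le_lt_trans (metric_triangle _ y _))// (splitr r) ltrD//.
  exact: le_lt_trans yz dr.
have /(_ i) fxy : forall i, mdist (f i x) (f i y) < e / 2.
  by apply: fr; rewrite /= (lt_trans xy)// ltr_pdivrMr// ltr_pMr// ltr1n.
have /(_ i) fxz := fr _ xz.
rewrite (splitr e) (le_trans (metric_triangle _ (f i x) _))// lerD// ltW//.
by rewrite metric_sym.
Unshelve. all: by end_near. Qed.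

(** For fixed [k], uniform continuity keeps the errors of the jumps small along the remaining steps.
    This turns [k] steps of a chain of $G$ into one step for $G^k$. *)
Lemma word_of_reach k e : 0 < e -> exists2 d : R, 0 < d &
  forall x y, reach setT f d k x y ->
    exists w : k.-tuple I, mdist (power_family f w x) y <= e.
Proof.
elim: k e => [|k IHk] e e0.
  by exists e => // x y [_ ->]; exists [tuple]; rewrite mdistxx ltW.
have e20 : 0 < e / 2 by rewrite divr_gt0.
have [d1 d10 fd1] := uniform_modulus e20.
have [d d0 dw] := IHk _ d10.
exists (Num.min d (e / 2)) => [|x y xy]; first by rewrite lt_min d0.
(* The first letter of a word acts last, so the chain is split before its last step, which provides
   the new first letter. *)
have /reach_cat[z [xz [i [t [_ zt [_ ty]]]]]] :
  reach setT f (Num.min d (e / 2)) (k + 1) x y by rewrite addn1.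
subst t.
have [|w xw] := dw x z; first by apply: reach_weaken xz; rewrite ge_min lexx.
exists (cons_tuple i w) => /=.
rewrite (splitr e) (le_trans (metric_triangle _ (f i z) _))// lerD//.
  exact: fd1.
by rewrite (le_trans zt)// ge_min lexx orbT.
Qed.

End compactness.
End reach.

Section power.
Context {R : realType} {X : metricType R} {I : Type} (f : I -> X -> X).

(** Only every [k]-th point of the chain is kept; those in between leave [A] when [A] is one of
    several cyclically permuted classes. *)
Lemma reach_power (A : set X) (d e : R) (k n : nat) (x y : X) :
  (forall z t, reach setT f d k z t -> A z -> A t) ->
  (forall z t, reach setT f d k z t ->
    exists w : k.-tuple I, mdist (power_family f w z) t <= e) ->
  A x -> reach setT f d (n * k) x y ->
  reach A (@power_family R X I f k) e n x y.
Proof.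
move=> fA fw; elim: n x => [|n IHn] x Ax; first by rewrite mul0n => -[_ <-].
rewrite mulSn => /reach_cat[z [xz zy]]; have [w wz] := fw _ _ xz.
by exists w, z; split => //; apply: IHn => //; exact: fA xz Ax.
Qed.

End power.

(** A local witness [n] serves every [N >= n], so compactness, as a near covering property for the
    filter [\oo], yields one [N]. *)
Lemma bounded_of_locally_bounded (X : topologicalType) (Q : X -> set nat) :
  compact [set: X] ->
  (forall x : X, exists n, \forall y \near x, Q y n) ->
  exists N, forall x, exists2 n, (n <= N)%N & Q x n.
Proof.
move=> X_compact Qloc.
suff [N _ QN] : \forall N \near \oo, [set: X] `<=`
    (fun x => exists2 n, (n <= N)%N & Q x n).
  by exists N => x; exact: (QN N (leqnn N)).
apply: ((compact_near_coveringP _).1 X_compact) => x _.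
have [n Qn] := Qloc x.
near=> y N; have nN : (n <= N)%N by near: N; exact: nbhs_infty_ge.
by have Qyn : Q y n by [near: y; exact: Qn]; exists n.
Unshelve. all: by end_near. Qed.

(** * Periods and ranks *)

Section chain_period.
Context {R : realType} {X : metricType R} {T : finType} (f : T -> X -> X).
Context (f_trans : chain_transitive [set: X] f) (x0 : X).
Implicit Types (d e : R) (x y z : X) (n : nat).

Local Notation reach := (reach [set: X] f).
Local Notation period e := (chain_period f e x0).

Lemma exists_reach e x y : 0 < e -> exists2 n, (0 < n)%N & reach e n x y.
Proof. by move=> /f_trans /(_ x y I I)[n /chain_lengthP[]]; exists n. Qed.

Lemma chain_period_dvd e n x : reach e n x x -> (chain_period f e x %| n)%N.
Proof.
case: n => // n xx; apply: (gcd_setP _).1; exact/chain_lengthP.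
Qed.

(** Inserting a loop of length [n] at [z] into a closed chain at [y] through [z] gives another
    closed chain at [y], so the period at [y] divides [n]. *)
Lemma chain_periodE e x : 0 < e -> chain_period f e x = period e.
Proof.
move=> e0; suff dvd y z : (chain_period f e y %| chain_period f e z)%N.
  by apply/eqP; rewrite eqn_dvd !dvd.
apply: (gcd_setP _).2 => n /chain_lengthP[_ zz].
have [p _ yz] := exists_reach y z e0; have [q _ zy] := exists_reach z y e0.
have yy : reach e (p + q) y y by apply/reach_cat; exists z.
rewrite -(dvdn_addr n (chain_period_dvd yy)); apply: chain_period_dvd.
rewrite addnAC; apply/reach_cat; exists z; split => //.
by apply/reach_cat; exists z.
Qed.

Lemma chain_period_gt0 e : 0 < e -> (0 < period e)%N.
Proof.
move=> e0; have [n n0 /chain_period_dvd kn] := exists_reach x0 x0 e0.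
exact: dvdn_gt0 kn.
Qed.

Lemma chain_period_le d e : d <= e -> (period e %| period d)%N.
Proof.
move=> de; apply: (gcd_setP _).2 => n /chain_lengthP[_ /(reach_weaken de)].
exact: chain_period_dvd.
Qed.

(** An arbitrary choice of length, meaningful modulo the period; for [e > 0] transitivity rules out
    the default [0]. *)
Definition rank e y : nat := xget 0%N (chain_length [set: X] f e x0 y).

Lemma rankP e y : 0 < e -> (0 < rank e y)%N /\ reach e (rank e y) x0 y.
Proof.
move=> e0; apply/chain_lengthP; apply: (xgetPex 0%N).
by have [n n0 xy] := exists_reach x0 y e0; exists n; apply/chain_lengthP.
Qed.

(** The chosen chain to [y] and the one through [x] are closed up by the same chain from [y] to
    [x0]; both total lengths are multiples of the period. *)
Lemma rank_reach e n x y : 0 < e -> reach e n x y ->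
  rank e y = rank e x + n %[mod period e].
Proof.
move=> e0 xy; have [p _ yx0] := exists_reach y x0 e0.
apply/eqP; rewrite -(eqn_modDr p); apply/eqP.
have dvd q : reach e q x0 y -> q + p = 0 %[mod period e].
  move=> x0y; rewrite mod0n; apply/eqP/chain_period_dvd.
  by apply/reach_cat; exists y.
rewrite !dvd//; last by have [] := rankP y e0.
by apply/reach_cat; exists x; split => //; have [] := rankP x e0.
Qed.

Lemma rank_base e : 0 < e -> rank e x0 = 0 %[mod period e].
Proof.
by move=> e0; rewrite mod0n; apply/eqP/chain_period_dvd; have [] := rankP x0 e0.
Qed.

Lemma rank_base_reach e n y : 0 < e -> reach e n x0 y ->
  rank e y = n %[mod period e].
Proof.
by move=> e0 /(rank_reach e0) ->; rewrite -modnDml rank_base// modnDml.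
Qed.

Lemma rank_image e i y :
  0 < e -> rank e (f i y) = (rank e y).+1 %[mod period e].
Proof.
move=> e0; rewrite -addn1; apply: rank_reach => //.
exact: reach_orbit (ltW e0).
Qed.

Lemma rank_orbit e i n : 0 < e -> rank e (iter n (f i) x0) = n %[mod period e].
Proof.
by move=> e0; apply: rank_base_reach => //; exact: reach_orbit (ltW e0).
Qed.

Lemma rank_le d e y : 0 < d -> d <= e -> rank d y = rank e y %[mod period e].
Proof.
move=> d0 de; symmetry; apply: rank_base_reach; first exact: lt_le_trans de.
by apply: reach_weaken de _; have [] := rankP y d0.
Qed.

(** An [e / 2]-chain to [x], with its last jump redirected to [y], is an [e]-chain. *)
Lemma rank_locally_constant e x y : 0 < e -> mdist x y <= e / 2 ->
  rank e x = rank e y %[mod period e].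
Proof.
move=> e0 xy; have e20 : 0 < e / 2 by rewrite divr_gt0.
have [r0 x0x] := rankP x e20.
rewrite -(rank_le x e20); last by rewrite ler_pdivrMr// ler_pMr// ler1n.
symmetry; apply: rank_base_reach => //.
by rewrite [X in reach X](splitr e); exact: reach_last (ltW e20) r0 x0x xy.
Qed.

Lemma near_rank e x : 0 < e ->
  \forall y \near x, rank e y = rank e x %[mod period e].
Proof.
move=> e0; have e20 : 0 < e / 2 by rewrite divr_gt0.
apply: filterS (nbhsx_ballx x _ e20) => y; rewrite ballEmdist/= => /ltW xy.
by symmetry; exact: rank_locally_constant.
Qed.

Lemma rank_open e (Q : set nat) : 0 < e ->
  open [set y | Q (rank e y %% period e)%N].
Proof.
move=> e0; rewrite openE => x /= Qx; rewrite /interior.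
by apply: filterS (near_rank x e0) => y /= ->.
Qed.

Lemma rank_closed e (Q : set nat) : 0 < e ->
  closed [set y | Q (rank e y %% period e)%N].
Proof. by move=> e0; rewrite -openC; exact: (rank_open (~` Q)). Qed.

Lemma sim_epsP e x y : 0 < e ->
  sim_eps f e x y <-> rank e x = rank e y %[mod period e].
Proof.
move=> e0; rewrite /sim_eps; split=> [[n [/chain_lengthP[_ xy]]]|xy].
  rewrite chain_periodE// => kn; rewrite (rank_reach e0 xy).
  by rewrite -modnDmr (eqP kn) addn0.
have [n n0 reach_xy] := exists_reach x y e0; exists n.
rewrite chain_periodE//; split; first exact/chain_lengthP.
move: xy; rewrite (rank_reach e0 reach_xy) -[in LHS](addn0 (rank e x)).
by move/eqP; rewrite eqn_modDl mod0n eq_sym.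
Qed.

Section bounds.
Context (X_compact : compact [set: X]) (f_cont : forall i, continuous (f i)).

Lemma bounded_reach_from e : 0 < e ->
  exists N, forall y, exists2 n, (n <= N)%N & reach e n x0 y.
Proof.
move=> e0; have e20 : 0 < e / 2 by rewrite divr_gt0.
apply: bounded_of_locally_bounded => // x.
have [n n0 x0x] := exists_reach x0 x e20; exists n.
apply: filterS (nbhsx_ballx x _ e20) => y; rewrite ballEmdist/= => /ltW xy.
by rewrite (splitr e); exact: reach_last (ltW e20) n0 x0x xy.
Qed.

(** A move of the start from [x] to [y] is absorbed by a first jump from [f i y] to [f i x], so the
    chain is continued from [f i x]. *)
Lemma bounded_reach_to e (i : T) : 0 < e ->
  exists N, forall x, exists2 n, (n <= N)%N & reach e n x x0.
Proof.
move=> e0; apply: bounded_of_locally_bounded => // x.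
have [n n0 xx0] := exists_reach (f i x) x0 e0; exists n.+1.
have fx : \forall y \near x, ball (f i x) e (f i y).
  exact: f_cont (nbhsx_ballx (f i x) _ e0).
apply: filterS fx => y; rewrite ballEmdist/= metric_sym => /ltW xy.
by exists i, (f i x).
Qed.

End bounds.
End chain_period.

(** * Bounded periods: the cyclic decomposition *)

Section bounded_period.
Context {R : realType} {X : metricType R} {T : finType} (f : T -> X -> X).
Context (f_trans : chain_transitive [set: X] f) (x0 : X) (i0 : T).
Context (X_compact : compact [set: X]) (f_cont : forall i, continuous (f i)).
Context (e0 : R) (e0_gt0 : 0 < e0).
Local Notation k := (chain_period f e0 x0).
Context (period_stable :
  forall e : R, 0 < e -> e <= e0 -> chain_period f e x0 = k).

(** For [e <= e0] the period and the rank modulo [k] are those at [e0], and for larger [e] the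
    period divides [k]; so [sim_eps f e0] is the finest of these relations. The scale [Num.min e e0]
    covers both cases. *)
Lemma sim_rank x y :
  sim f x y <-> rank f x0 e0 x = rank f x0 e0 y %[mod k].
Proof.
split=> [/(_ e0 e0_gt0)/(sim_epsP f_trans x0)|xy e e_gt0]; first exact.
have d_gt0 : 0 < Num.min e e0 by rewrite lt_min e_gt0.
have [de de0] : Num.min e e0 <= e /\ Num.min e e0 <= e0.
  by rewrite !ge_min !lexx orbT.
apply/(sim_epsP f_trans x0) => //.
rewrite -(rank_le f_trans x0 x d_gt0 de) -(rank_le f_trans x0 y d_gt0 de).
have ke := chain_period_le f x0 de.
rewrite -(modn_dvdm _ ke) -[in RHS](modn_dvdm _ ke) (period_stable d_gt0 de0).
by rewrite !(rank_le f_trans x0 _ d_gt0 de0) xy.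
Qed.

Definition rank_class (r : nat) : set X :=
  [set y | (rank f x0 e0 y %% k)%N = r].

Lemma reach_large_multiples e : 0 < e -> e <= e0 ->
  exists N, forall r x y, rank_class r x -> rank_class r y ->
    forall n, (N <= n)%N -> reach setT f e (n * k) x y.
Proof.
move=> e_gt0 ee0; have ke := period_stable e_gt0 ee0.
have k_gt0 := chain_period_gt0 f_trans x0 e0_gt0.
have [N0 N0P] : exists N, forall n, (N <= n)%N ->
    chain_length setT f e x0 x0 (k * n).
  apply: additive_set_multiples.
  - move=> a b /chain_lengthP[a0 xa] /chain_lengthP[b0 xb]; apply/chain_lengthP.
    by rewrite addn_gt0 a0; split => //; apply/reach_cat; exists x0.
  - have [n n0 xx] := exists_reach f_trans x0 x0 e_gt0.
    by exists n => //; exact/chain_lengthP.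
  - by rewrite -ke; exact: gcd_setP.
have [M MP] := bounded_reach_from f_trans x0 X_compact e_gt0.
have [M' MP'] := bounded_reach_to f_trans x0 X_compact f_cont i0 e_gt0.
(* The chain goes from [x] to [x0] in [q] steps, loops there, and reaches [y] in [p] more, with
   [q + p = s * k]. As [s <= M + M'], the loop has length [k * (n - s)] with [n - s >= N0]. *)
exists (N0 + M + M')%N => r x y xr yr n Nn.
have [p pM x0y] := MP y; have [q qM xx0] := MP' x.
have /dvdnP[s spq] : (k %| q + p)%N.
  rewrite -ke; apply/eqP; rewrite -[RHS](mod0n (chain_period f e x0)).
  have xy : rank f x0 e x = rank f x0 e y %[mod chain_period f e x0].
    rewrite ke.
    rewrite (rank_le f_trans x0 x e_gt0 ee0) (rank_le f_trans x0 y e_gt0 ee0).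
    by rewrite xr yr.
  rewrite -(rank_base f_trans x0 e_gt0) (rank_reach f_trans x0 e_gt0 xx0).
  rewrite addnC -modnDml -(rank_base_reach f_trans e_gt0 x0y) -xy modnDml.
  by rewrite addnC.
have sn : (N0 + s <= n)%N.
  apply: leq_trans Nn; rewrite -addnA leq_add2l.
  by rewrite -(leq_pmul2r k_gt0) -spq; nia.
have -> : (n * k = q + (k * (n - s) + p))%N.
  have : (n * k = (n - s) * k + s * k)%N by rewrite -mulnDl subnK//; lia.
  by rewrite -spq; lia.
apply/reach_cat; exists x0; split => //.
apply/reach_cat; exists x0; split => //.
by have /chain_lengthP[] := N0P (n - s)%N ltac:(lia).
Qed.

Lemma chain_mixing_rank_class r :
  chain_mixing (rank_class r) (@power_family R X T f k).
Proof.
move=> e e_gt0; have [d d_gt0 dw] := word_of_reach X_compact f_cont k e_gt0.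
(* Below [d], [k] steps amount to one map of $G^k$ up to [e]; below [e0], they preserve the rank
   modulo [k]. *)
have de_gt0 : 0 < Num.min d e0 by rewrite lt_min d_gt0.
have [dd de0] : Num.min d e0 <= d /\ Num.min d e0 <= e0.
  by rewrite !ge_min !lexx orbT.
have [N NP] := reach_large_multiples de_gt0 de0.
exists N.+1; split => // x y xr yr n Nn; apply/chain_lengthP.
split; first exact: leq_trans Nn.
apply: (reach_power (d := Num.min d e0)) => //.
- move=> z t /(reach_weaken de0)/(rank_reach f_trans x0 e0_gt0) zt.
  by rewrite /rank_class/= zt modnDr.
- by move=> z t /(reach_weaken dd)/dw.
- by apply: NP xr yr _ _; exact: ltnW.
Qed.

Lemma cyclic_decomposition :
  exists (k : nat) (C : 'I_k -> set X),
    (1 <= k)%N /\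
    [/\ forall i, sim_class f (C i),
        trivIset [set: 'I_k] C,
        \bigcup_i C i = [set: X],
        forall i, open (C i) /\ closed (C i) &
        forall (j : T) (i : 'I_k), f j @` C i `<=` C (ordS i)] /\
    forall i, chain_mixing (C i) (@power_family R X T f k).
Proof.
have k_gt0 := chain_period_gt0 f_trans x0 e0_gt0.
exists k, (fun i => rank_class i); split => //.
split; last by move=> i; exact: chain_mixing_rank_class.
split.
(* This orbit point has rank [i], hence represents the level set. *)
- move=> i; exists (iter i (f i0) x0); apply/seteqP.
  have ri := rank_orbit f_trans x0 i0 i e0_gt0.
  split=> y; rewrite /rank_class/=.
    by move=> yi; apply/sim_rank; rewrite ri yi modn_small.
  by move=> /sim_rank <-; rewrite ri modn_small.
- by move=> i j _ _ [y [/= yi yj]]; apply/val_inj; rewrite /= -yi -yj.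
- apply/seteqP; split=> // y _.
  by exists (Ordinal (ltn_pmod (rank f x0 e0 y) k_gt0)).
- move=> i; split; first exact: (rank_open f_trans x0 [set nat_of_ord i]).
  exact: (rank_closed f_trans (Q := [set nat_of_ord i]) e0_gt0).
- move=> j i _ [y yi <-]; rewrite /rank_class/= rank_image//.
  by rewrite -addn1 -modnDml yi addn1.
Qed.

End bounded_period.

(** * Unbounded periods: the factor map onto an adding machine *)

Section unbounded_period.
Context {R : realType} {X : metricType R} {T : finType} (f : T -> X -> X).
Context (f_trans : chain_transitive [set: X] f) (x0 : X) (i0 : T).
Context (X_compact : compact [set: X]).
Local Notation period e := (chain_period f e x0).
Context (period_unbounded : forall K, exists2 e : R, 0 < e & (K < period e)%N).

Lemma adding_machine_factor :
  exists (J : nat -> nat) (J2 : forall i, (2 <= J i)%N)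
      (pi : X -> adding_space J),
    [/\ continuous pi,
        set_surj [set: X] [set: adding_space J] pi &
        forall j : T, pi \o f j = adding_map J2 \o pi].
Proof.
(* The premise [0 < e] sits inside the existential so that [choice] yields a function on all reals;
   [0] is a dummy value. *)
have period_grows (e : R) : exists d : R, 0 < e ->
    [/\ 0 < d, d <= e & (period e < period d)%N].
  have [e_gt0|_] := ltP 0 e; last by exists 0.
  have [d d_gt0 ed] := period_unbounded (period e).
  have m_gt0 : 0 < Num.min d e by rewrite lt_min d_gt0.
  exists (Num.min d e) => _; split => //; first by rewrite ge_min lexx orbT.
  apply: leq_trans ed _; apply: dvdn_leq; first exact: chain_period_gt0.
  by apply: chain_period_le; rewrite ge_min lexx.
have [g gP] := choice period_grows.
(* Starting at [g 1] makes the first period exceed the one at scale [1], so that [J 0 >= 2]. *)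
pose E n := iter n.+1 g 1.
have E_gt0 n : 0 < E n.
  rewrite /E; elim: n => [|n IHn] /=; first by have [] := gP 1 ltr01.
  by have [] := gP _ IHn.
have E_le n p : (n <= p)%N -> E p <= E n.
  elim: p => [|p IHp]; first by rewrite leqn0 => /eqP ->.
  rewrite leq_eqVlt => /predU1P[->//|/IHp]; apply: le_trans.
  by have [] := gP _ (E_gt0 p).
(* The shift by one fits the digits: the rank at scale [E n] is defined modulo [P n.+1], which
   determines its digits up to place [n]. *)
pose P n := if n is n'.+1 then period (E n') else 1%N.
pose J n := (P n.+1 %/ P n)%N.
have P_gt0 n : (0 < P n)%N by case: n => //= n; exact: chain_period_gt0.
have P_lt n : (P n < P n.+1)%N.
  case: n => [|n] /=; last by have [] := gP _ (E_gt0 n).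
  have [_ _] := gP 1 ltr01; apply: leq_ltn_trans.
  exact: chain_period_gt0.
have PS n : P n.+1 = (P n * J n)%N.
  rewrite mulnC divnK//; case: n => [|n]; first exact: dvd1n.
  by apply: chain_period_le; exact: E_le.
have J2 n : (2 <= J n)%N.
  by rewrite -(ltn_pmul2l (P_gt0 n)) muln1 -PS.
pose r n x := rank f x0 (E n) x.
have r_mono n p x : (n <= p)%N -> r p x = r n x %[mod P n.+1].
  by move=> np; apply: rank_le => //; exact: E_le.
pose pi (x : X) : adding_space J := fun n =>
  Ordinal (ltn_pmod (r n x %/ P n) (ltnW (J2 n))).
have piE n x : pi x n = radix_digit (J := J) (P := P) (r n x) n :> nat by [].
have pi_le n p x : (n <= p)%N ->
    pi x n = radix_digit (J := J) (P := P) (r p x) n :> nat.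
  by move=> np; rewrite piE; apply: radix_digit_mod => //; rewrite r_mono.
have pi_near n x : \forall y \near x, pi y n = pi x n.
  apply: filterS (near_rank f_trans x0 x (E_gt0 n)) => y yx.
  by apply/val_inj; exact: (radix_digit_mod PS yx).
exists J, J2, pi; split.
- move=> x; apply/cvg_sup => n.
  move=> A; rewrite /nbhs /= => -[B [[U oU <-] Ux] UA].
  by apply: filterS (pi_near n x) => y yx; apply: UA; rewrite /= yx.
- move=> a _.
  have [u au] : exists u : nat -> nat, forall p n, (n <= p)%N ->
      a n = radix_digit (J := J) (P := P) (u p) n :> nat.
    have H p := radix_digit_surj J2 (erefl : P 0 = 1%N) PS a p.+1.
    by have [u uP] := choice H; exists u => p n; exact: uP.
  (* The rank of [y p] is [u p] modulo every period, so its image agrees with [a] up to place [p].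
     As each coordinate of [pi] is locally constant, any cluster point of [y] is mapped to [a]. *)
  pose y p := iter (u p) (f i0) x0.
  have piy p n : (n <= p)%N -> pi (y p) n = a n.
    move=> np; apply/val_inj.
    transitivity (radix_digit (J := J) (P := P) (u p) n).
      by apply: radix_digit_mod => //; exact: rank_orbit.
    by rewrite -au.
  have [x [_ clx]] := X_compact (fmap_proper_filter y eventually_filter) filterT.
  exists x => //; apply/functional_extensionality_dep => n.
  have yn : (y @ \oo) [set y p | p in [set p | (n <= p)%N]].
    by exists n => // p /= np; exists p.
  by have [z [[p np <-] /= <-]] := clx _ _ yn (pi_near n x); exact: piy.
- move=> j; apply/funext => x /=; apply: functional_extensionality_dep => n.
  (* The coordinates of [pi x] up to [n] are digits of the single integer [r n x], so adding 1 to it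
     produces the right carries. *)
  apply/val_inj; transitivity (radix_digit (J := J) (P := P) (r n x).+1 n).
    by apply: (radix_digit_mod PS); exact: rank_image.
  by symmetry; apply: (adding_map_digit J2) => // l; exact: pi_le.
Qed.

End unbounded_period.

Theorem theorem1p4 (R : realType) (X : metricType R)
    (X_nonempty : [set: X] !=set0) (X_compact : compact [set: X])
    (m : nat) (m_gt0 : (1 <= m)%N) (f : 'I_m -> X -> X)
    (f_cont : forall j, continuous (f j))
    (f_trans : chain_transitive [set: X] f) :
  (exists (k : nat) (C : 'I_k -> set X),
    (1 <= k)%N /\
    [/\ forall i, sim_class f (C i),
        trivIset [set: 'I_k] C,
        \bigcup_i C i = [set: X],
        forall i, open (C i) /\ closed (C i) &
        forall (j : 'I_m) (i : 'I_k), f j @` C i `<=` C (ordS i)] /\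
    forall i, chain_mixing (C i) (@power_family R X 'I_m f k))
  \/
  (exists (J : nat -> nat) (J2 : forall i, (2 <= J i)%N)
      (pi : X -> adding_space J),
    [/\ continuous pi,
        set_surj [set: X] [set: adding_space J] pi &
        forall j : 'I_m, pi \o f j = adding_map J2 \o pi]).
Proof.
have [x0 _] := X_nonempty; have i0 := Ordinal m_gt0.
have [unbounded|bounded] := pselect
    (forall K, exists2 e : R, 0 < e & (K < chain_period f e x0)%N).
  by right; exact: adding_machine_factor unbounded.
left; have [K KP] : exists K, forall e : R, 0 < e ->
    (chain_period f e x0 <= K)%N.
  move/existsNP: bounded => [K nK]; exists K => e e_gt0; rewrite leqNgt.
  by apply/negP => Ke; apply: nK; exists e.
(* The largest period is attained at some [e0]; for [e <= e0] the period is a multiple of it, hence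
   equal to it. *)
pose V n := `[< exists2 e : R, 0 < e & chain_period f e x0 = n >].
have exV : exists n, V n.
  by exists (chain_period f 1 x0); apply/asboolP; exists 1.
have leV n : V n -> (n <= K)%N by move=> /asboolP[e e_gt0 <-]; exact: KP.
case: (ex_maxnP exV leV) => k /asboolP[e0 e0_gt0 ek] kmax.
apply: (cyclic_decomposition f_trans (x0 := x0) i0 X_compact f_cont e0_gt0).
move=> e e_gt0 ee0; apply/eqP; rewrite eqn_leq; apply/andP; split.
  by rewrite ek; apply: kmax; apply/asboolP; exists e.
apply: dvdn_leq; first exact: chain_period_gt0.
exact: chain_period_le.
Qed.
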